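(* Let $A$ be a $C^*$-algebra and $E$ a Hilbert $A$-module. Let $T$ be a regular self-adjoint operator on $E$, and let $R$ be relatively $T$-compact. Then for all $\epsilon>0$ there exists $C_\epsilon\geq0$ such that for all $\psi\in\operatorname{Dom}(T)$ we have $$\|R\psi\|\leq\epsilon\|T\psi\|+C_\epsilon\|\psi\|.$$
   Context: A densely defined operator $S$ on $E$ is regular if it is closed, $S^*$ is densely defined, and $1+S^*S$ has dense range. For $T$ regular self-adjoint, a densely defined operator $R$ on $E$ is relatively $T$-compact if $\operatorname{Dom}(T)\subset\operatorname{Dom}(R)$ and $R(T\pm i)^{-1}$ is compact, i.e. lies in $\mathcal K_A(E)$, the norm closure of the span of the rank-one operators $\theta_{\psi,\eta}\xi=\psi\langle\eta|\xi\rangle$. *)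

(* Defs.v *)
From HB Require Import structures.
From mathcomp Require Import all_boot all_order all_algebra.
From mathcomp Require Import complex.
From mathcomp Require Import all_classical all_reals all_analysis.

Set Implicit Arguments.
Unset Strict Implicit.
Unset Printing Implicit Defensive.

Import Order.TTheory GRing.Theory Num.Theory numFieldNormedType.Exports.

Local Open Scope classical_set_scope.
Local Open Scope complex_scope.
Local Open Scope ring_scope.

(* The complex numbers are R[i] for R : realType. Norms on a normedModType     *)
(* R[i] take their values in R[i]; for z, w : R[i], 0 <= z implies that z is   *)
(* real, and z <= w implies that w - z is real.                                *)

(* A C*-algebra is not assumed to be unital (nor nonzero), so the              *)
(* multiplication cannot come from the MathComp ring structures.               *)
HB.mixin Record isCStarAlgebra (R : realType) A
    & CompleteNormedModule R[i] A := {
  cmul : A -> A -> A;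
  cstar : A -> A;
  cmulA : forall a b c, cmul a (cmul b c) = cmul (cmul a b) c;
  cmul_linearl : forall (k : R[i]) (a b c : A),
    cmul (k *: a + b) c = k *: cmul a c + cmul b c;
  cmul_linearr : forall (k : R[i]) (a b c : A),
    cmul a (k *: b + c) = k *: cmul a b + cmul a c;
  cmul_norm_le : forall a b : A, `|cmul a b| <= `|a| * `|b|;
  cstar_antilinear : forall (k : R[i]) (a b : A),
    cstar (k *: a + b) = (k^*)%R *: cstar a + cstar b;
  cstarM : forall a b, cstar (cmul a b) = cmul (cstar b) (cstar a);
  cstarK : forall a, cstar (cstar a) = a;
  cstar_identity : forall a : A, `|cmul (cstar a) a| = `|a| ^+ 2
}.

#[short(type="cstarAlgType")]
HB.structure Definition CStarAlgebra (R : realType) :=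
  {A of isCStarAlgebra R A & CompleteNormedModule R[i] A}.

Definition cpositive (R : realType) (A : cstarAlgType R) (a : A) : Prop :=
  exists b : A, a = cmul (cstar b) b.

(* Right Hilbert A-modules, with an inner product that is linear in its        *)
(* second argument. By inner_norm the given norm is ||<x|x>||^(1/2), so that   *)
(* completeness for this norm is the one inherited from CompleteNormedModule,  *)
(* and x = 0 as soon as <x|x> = 0.                                             *)
HB.mixin Record isHilbertModule (R : realType) (A : cstarAlgType R) E
    & CompleteNormedModule R[i] E := {
  act : E -> A -> E;
  inner : E -> E -> A;
  actA : forall (x : E) (a b : A), act (act x a) b = act x (cmul a b);
  act_linearl : forall (k : R[i]) (x y : E) (a : A),
    act (k *: x + y) a = k *: act x a + act y a;
  act_linearr : forall (k : R[i]) (x : E) (a b : A),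
    act x (k *: a + b) = k *: act x a + act x b;
  inner_linearr : forall (k : R[i]) (x y z : E),
    inner x (k *: y + z) = k *: inner x y + inner x z;
  inner_actr : forall (x y : E) (a : A), inner x (act y a) = cmul (inner x y) a;
  inner_star : forall x y : E, cstar (inner x y) = inner y x;
  inner_positive : forall x : E, cpositive (inner x x);
  inner_norm : forall x : E, `|x| ^+ 2 = `|inner x x|
}.

#[short(type="hilbertModType")]
HB.structure Definition HilbertModule (R : realType) (A : cstarAlgType R) :=
  {E of isHilbertModule R A E & CompleteNormedModule R[i] E}.

(* A densely defined operator on E is an A-linear map on a dense A-submodule.  *)
(* The values of opval outside of dom are irrelevant.                          *)
Record ddOperator (R : realType) (A : cstarAlgType R) (E : hilbertModType A) :=
  DDOperator {
  dom : set E;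
  opval :> E -> E;
  dom_dense : dense dom;
  dom_linear : forall (k : R[i]) (x y : E),
    dom x -> dom y -> dom (k *: x + y);
  dom_act : forall (x : E) (a : A), dom x -> dom (act x a);
  opval_linear : forall (k : R[i]) (x y : E),
    dom x -> dom y -> opval (k *: x + y) = k *: opval x + opval y;
  opval_act : forall (x : E) (a : A),
    dom x -> opval (act x a) = act (opval x) a
}.

Section Operators.
Context (R : realType) (A : cstarAlgType R) (E : hilbertModType A).

(* The operators built from a densely defined operator (adjoints, sums,        *)
(* products, inverses) are handled through their graphs, as subsets of E * E;  *)
(* in relation_scope, G \; F is the graph of "F followed by G" and G^-1 is the *)
(* graph of the inverse.                                                       *)
Definition graph (S : ddOperator E) : set (E * E) :=
  [set p | dom S p.1 /\ p.2 = S p.1].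

Definition graph_dom (G : set (E * E)) : set E := fst @` G.

Definition graph_ran (G : set (E * E)) : set E := snd @` G.

Definition graph_addc (G : set (E * E)) (z : R[i]) : set (E * E) :=
  [set (p.1, p.2 + z *: p.1) | p in G].

(* Single-valued because dom S is dense. *)
Definition adjoint (S : ddOperator E) : set (E * E) :=
  [set p | forall x, dom S x -> inner (S x) p.1 = inner x p.2 :> A].

Definition regular_op (S : ddOperator E) : Prop :=
  [/\ closed (graph S),
      dense (graph_dom (adjoint S)) &
      dense (graph_ran (graph_addc (adjoint S \; graph S)%relation 1))].

Definition selfadjoint_op (S : ddOperator E) : Prop := adjoint S = graph S.

Definition rank_one (psi eta : E) : E -> E :=
  fun xi => act psi (inner eta xi : A).

Definition finite_rank_op (F : E -> E) : Prop :=
  exists (n : nat) (c : 'I_n -> R[i]) (psi eta : 'I_n -> E),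
    F = fun xi => \sum_(k < n) c k *: rank_one (psi k) (eta k) xi.

(* The inner bound says that the operator norm of K - F is at most e.  A norm  *)
(* limit of elements of the span of the rank-one operators is automatically    *)
(* linear, bounded and adjointable.                                            *)
Definition compact_op (K : E -> E) : Prop :=
  forall e : R, 0 < e -> exists2 F : E -> E, finite_rank_op F &
    forall xi : E, `|K xi - F xi| <= e%:C * `|xi|.

(* The operator with graph G is everywhere defined and compact. *)
Definition compact_graph (G : set (E * E)) : Prop :=
  exists2 K : E -> E, compact_op K & G = [set p | p.2 = K p.1].

(* The inverses exist for T regular and self-adjoint: T + i and T - i are then *)
(* bijections from dom T onto E.                                               *)
Definition relatively_compact (T S : ddOperator E) : Prop :=
  [/\ dom T `<=` dom S,
      compact_graph (graph S \; (graph_addc (graph T) 'i)^-1)%relation &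
      compact_graph (graph S \; (graph_addc (graph T) (- 'i))^-1)%relation].

End Operators.

(* Main.v *)
(* With K := S (T + i)^-1 compact, S psi = K (T psi + i psi) on dom T, so it
   suffices to treat K of rank one, relative bound zero being stable under
   linear combinations and norm limits.  For K = theta_(p, eta), choose xi in
   dom T close to eta: then <eta | T psi> = <eta - xi | T psi> + <T xi | psi>,
   where the first term is small relative to |T psi| and the second is bounded
   by a multiple of |psi|. *)
Require Import Defs.
From HB Require Import structures.
From mathcomp Require Import all_boot all_order all_algebra.
From mathcomp Require Import complex.
From mathcomp Require Import all_classical all_reals all_analysis.
From mathcomp Require Import ring.

Set Implicit Arguments.
Unset Strict Implicit.
Unset Printing Implicit Defensive.

Import Order.TTheory GRing.Theory Num.Theory numFieldNormedType.Exports.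

Local Open Scope classical_set_scope.
Local Open Scope complex_scope.
Local Open Scope ring_scope.

Section CStar.
Context (R : realType) (A : cstarAlgType R).
Implicit Types a b : A.

Lemma cstarD a b : cstar (a + b) = cstar a + cstar b.
Proof. by have := cstar_antilinear 1 a b; rewrite rmorph1 !scale1r. Qed.

Lemma cstar0 : cstar (0 : A) = 0.
Proof. by apply: (addrI (cstar (0 : A))); rewrite -cstarD !addr0. Qed.

Lemma cstarZ (k : R[i]) a : cstar (k *: a) = (k^*)%R *: cstar a.
Proof. by have := cstar_antilinear k a 0; rewrite cstar0 !addr0. Qed.

(** The C*-identity and submultiplicativity bound the square of [|b|] by [|cstar b| * |b|];
    cancelling [|b|] and then using [cstarK] yields both inequalities. *)
Lemma cstar_norm a : `|cstar a| = `|a|.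
Proof.
have le b : `|b| <= `|cstar b|.
  have [->|b0] := eqVneq b 0; first by rewrite normr0.
  rewrite -(@ler_pM2r _ `|b|) ?normr_gt0// -expr2 -cstar_identity.
  exact: cmul_norm_le.
by apply/le_anti; rewrite le /= -{2}(cstarK a) le.
Qed.

End CStar.

Section Inner.
Context (R : realType) (A : cstarAlgType R) (E : hilbertModType A).
Implicit Types x y z : E.

HB.instance Definition _ x := GRing.isLinear.Build R[i] E A *:%R
  (inner x : E -> A) (fun k => inner_linearr k x).

Lemma innerDl x y z : inner (x + y) z = inner x z + inner y z :> A.
Proof. by rewrite -[LHS]inner_star linearD cstarD !inner_star. Qed.

Lemma innerZl (k : R[i]) x y : inner (k *: x) y = (k^*)%R *: inner x y :> A.
Proof. by rewrite -[LHS]inner_star linearZ cstarZ inner_star. Qed.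

(** After squaring, [a] leaves the second slot of the inner product directly and the first slot
    through the isometric involution. *)
Lemma act_norm_le x (a : A) : `|act x a| <= `|x| * `|a|.
Proof.
rewrite -(@ler_pXn2r _ 2) ?nnegrE ?mulr_ge0// inner_norm inner_actr.
rewrite exprMn expr2 (expr2 `|a|) mulrA; apply: (le_trans (cmul_norm_le _ _)).
rewrite ler_wpM2r// -inner_star cstar_norm inner_actr -expr2 inner_norm.
exact: cmul_norm_le.
Qed.

Lemma inner_symm_norm_le x y :
  `|inner x y + inner y x : A| <= 2 * (`|x| + `|y|) ^+ 2.
Proof.
have -> : inner x y + inner y x =
    inner (x + y) (x + y) - inner x x - inner y y :> A.
  rewrite linearD /= !innerDl [RHS]addrAC addrA addrK addrAC.
  by rewrite (addrAC (inner x x)) subrr add0r addrC.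
do 2 rewrite (le_trans (ler_normB _ _))// -lerBrDr.
rewrite -!inner_norm !lerBrDr -addrA mulrDl mul1r lerD//.
  by rewrite ler_pXn2r ?nnegrE ?addr_ge0// ler_normD.
by rewrite sqrrD addrAC lerDl mulrn_wge0// mulr_ge0.
Qed.

(* Polarization only uses the triangle inequality for the norm of E, so it
   avoids the order of A, at the price of the constant. *)
Lemma inner_norm_le x y : `|inner x y : A| <= 8 * (`|x| * `|y|).
Proof.
have polar (u v : E) : `|inner u v : A| <= 2 * (`|u| + `|v|) ^+ 2.
  (* The pair [u], ['i *: v] isolates the antisymmetric part of the inner product, so both brackets
     fall under [inner_symm_norm_le]. *)
  have -> : inner u v = 2^-1 *: ((inner u v + inner v u)
      - 'i *: (inner u ('i *: v) + inner ('i *: v) u)) :> A.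
    rewrite [inner u (_ *: _)]linearZ /= innerZl (scalerDr 'i) !scalerA conjCi
      mulrN -expr2 sqrCi.
    rewrite opprK scale1r scaleN1r opprD opprK addrACA subrr addr0.
    by rewrite scalerDr -scalerDl -[2^-1]mul1r -splitr scale1r.
  rewrite normrZ ger0_norm ?invr_ge0// ler_pdivrMl//.
  rewrite (le_trans (ler_normB _ _))// normrZ normCi mul1r.
  rewrite [leRHS]mulrDl mul1r lerD ?inner_symm_norm_le//.
  by have := inner_symm_norm_le u ('i *: v); rewrite normrZ normCi mul1r.
have [->|x0] := eqVneq x 0.
  by rewrite -inner_star linear0 cstar0 !normr0 mul0r mulr0.
have [->|y0] := eqVneq y 0; first by rewrite linear0 !normr0 !mulr0.
(* At unit vectors the bound is 2 * (1 + 1) ^ 2 = 8; homogeneity restores the norms. *)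
have := polar (`|x|^-1 *: x) (`|y|^-1 *: y).
rewrite innerZl linearZ /= !normrZ norm_conjC !normfV !normr_id.
rewrite !mulVf ?normr_eq0// mulrA -invfM ler_pdivrMl ?mulr_gt0 ?normr_gt0//.
by rewrite mulrC; congr (_ <= _ * _); ring.
Qed.

End Inner.

Section RelativeBoundZero.
Context (R : realType) (A : cstarAlgType R) (E : hilbertModType A).
Implicit Types (T : ddOperator E) (F G : E -> E).

(** The constants live in [R[i]], like the norms; their sign conditions force them to be real. *)
Definition bound_zero T F : Prop :=
  forall eps : R[i], 0 < eps -> exists2 C : R[i], 0 <= C &
    forall psi, dom T psi -> `|F psi| <= eps * `|T psi| + C * `|psi|.

Lemma bound_zeroD T F G :
  bound_zero T F -> bound_zero T G -> bound_zero T (fun psi => F psi + G psi).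
Proof.
move=> bF bG eps eps0; have eps2 : 0 < eps / 2 by rewrite divr_gt0.
have [C C0 FC] := bF _ eps2; have [D D0 GD] := bG _ eps2.
exists (C + D); first exact: addr_ge0.
move=> psi Tpsi; apply: (le_trans (ler_normD _ _)).
apply: (le_trans (lerD (FC _ Tpsi) (GD _ Tpsi))).
by rewrite addrACA -mulrDl -splitr -mulrDl.
Qed.

Lemma bound_zeroZ T F (k : R[i]) :
  bound_zero T F -> bound_zero T (fun psi => k *: F psi).
Proof.
(* Adding 1 to [|k|] makes the divisor positive even for [k = 0]. *)
move=> bF eps eps0; have k1 : 0 < `|k| + 1 by rewrite ltr_wpDl.
have [C C0 FC] := bF _ (divr_gt0 eps0 k1).
exists ((`|k| + 1) * C); first by rewrite mulr_ge0// ltW.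
move=> psi Tpsi; rewrite normrZ.
apply: (@le_trans _ _ ((`|k| + 1) * `|F psi|)).
  by rewrite ler_wpM2r// lerDl.
apply: (le_trans (ler_wpM2l (ltW k1) (FC _ Tpsi))).
by rewrite mulrDr !mulrA (mulrC _ eps) mulfK ?gt_eqF.
Qed.

Lemma bound_zero_sum T n (F : 'I_n -> E -> E) :
  (forall k, bound_zero T (F k)) ->
  bound_zero T (fun psi => \sum_(k < n) F k psi).
Proof.
move=> bF; elim: n F bF => [|n IHn] F bF.
  move=> eps eps0; exists 0 => // psi _.
  by rewrite big_ord0 normr0 mul0r addr0 mulr_ge0// ltW.
under eq_fun do rewrite big_ord_recr.
by apply: bound_zeroD => //; apply: IHn.
Qed.

Lemma selfadjoint_inner T x y : selfadjoint_op T -> dom T x -> dom T y ->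
  inner (T x) y = inner x (T y) :> A.
Proof.
move=> Tsa Tx Ty; have : graph T (y, T y) by [].
by rewrite -Tsa; apply.
Qed.

Lemma dense_norm_lt (D : set E) (x : E) (e : R[i]) :
  dense D -> 0 < e -> exists2 y, D y & `|x - y| < e.
Proof.
move=> dD e0; have [] := dD (ball x e); last 1 first.
- by move=> y [xy Dy]; exists y => //; move: xy; rewrite -ball_normE.
- by exists x; apply: ballxx.
- exact: ball_open.
Qed.

Lemma bound_zero_rank_one T (psi0 eta : E) (z : R[i]) : selfadjoint_op T ->
  bound_zero T (fun psi => rank_one psi0 eta (T psi + z *: psi)).
Proof.
(* The 8 comes from [inner_norm_le]; the 1 keeps [c] invertible when [psi0 = 0]. *)
move=> Tsa eps eps0; pose c := 8 * `|psi0| + 1.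
have c0 : 0 < c by rewrite ltr_wpDl// mulr_ge0.
(* Moving eta into dom T lets T jump to the other side of the inner product,
   up to a small multiple of the norm of T psi. *)
have [xi Txi etaxi] := dense_norm_lt eta (@dom_dense _ _ _ T)
  (divr_gt0 eps0 c0).
exists (c * (`|T xi| + `|z| * `|eta|)).
  by rewrite mulr_ge0 ?addr_ge0 ?mulr_ge0// ltW.
move=> psi Tpsi; apply: (le_trans (act_norm_le _ _)).
have -> : inner eta (T psi + z *: psi) =
    inner (eta - xi) (T psi) + inner (T xi) psi + z *: inner eta psi :> A.
  by rewrite linearD linearZ /= selfadjoint_inner// -innerDl subrK.
apply: (@le_trans _ _ (`|psi0| * (8 * (`|eta - xi| * `|T psi|) +
    8 * (`|T xi| * `|psi|) + `|z| * (8 * (`|eta| * `|psi|))))).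
  rewrite ler_wpM2l// (le_trans (ler_normD _ _))// lerD//.
    by rewrite (le_trans (ler_normD _ _))// lerD// inner_norm_le.
  by rewrite normrZ ler_wpM2l// inner_norm_le.
rewrite [leLHS](_ : _ = 8 * `|psi0| * (`|eta - xi| * `|T psi| +
  (`|T xi| + `|z| * `|eta|) * `|psi|)); last by ring.
apply: (@le_trans _ _ (c * (`|eta - xi| * `|T psi| +
  (`|T xi| + `|z| * `|eta|) * `|psi|))).
  by rewrite ler_wpM2r ?addr_ge0 ?mulr_ge0 ?addr_ge0 ?mulr_ge0// lerDl.
rewrite mulrDr !mulrA lerD2r ler_wpM2r// -ler_pdivlMl// mulrC.
exact: ltW.
Qed.

Lemma bound_zero_finite_rank T F (z : R[i]) : selfadjoint_op T ->
  finite_rank_op F -> bound_zero T (fun psi => F (T psi + z *: psi)).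
Proof.
move=> Tsa [n [c [p [eta ->]]]].
by apply: bound_zero_sum => k; apply: bound_zeroZ; apply: bound_zero_rank_one.
Qed.

(** Half of [eps] pays for approximating [F] by a finite-rank [G], an error controlled by the norm
    of [T psi + z *: psi]; the other half is the relative bound of [G]. *)
Lemma bound_zero_compact T F (z : R[i]) : selfadjoint_op T ->
  compact_op F -> bound_zero T (fun psi => F (T psi + z *: psi)).
Proof.
move=> Tsa cF eps eps0; have eps2 : 0 < eps / 2 by rewrite divr_gt0.
have epsE : (complex.Re (eps / 2))%:C = eps / 2.
  by rewrite RRe_real// realE ltW.
have [|G rG FG] := cF (complex.Re (eps / 2)); first by rewrite -ltcR epsE.
have [C C0 GC] := bound_zero_finite_rank z Tsa rG eps2.
exists (eps / 2 * `|z| + C); first by rewrite addr_ge0 ?mulr_ge0// ltW.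
move=> psi Tpsi; rewrite -(subrK (G (T psi + z *: psi)) (F _)).
apply: (le_trans (ler_normD _ _)).
apply: (le_trans (lerD (FG _) (GC _ Tpsi))); rewrite epsE.
apply: (@le_trans _ _ (eps / 2 * (`|T psi| + `|z| * `|psi|) +
  (eps / 2 * `|T psi| + C * `|psi|))).
  rewrite lerD2r ler_wpM2l ?(ltW eps2)// -normrZ; exact: ler_normD.
rewrite [leLHS](_ : _ = (eps / 2 + eps / 2) * `|T psi| +
  (eps / 2 * `|z| + C) * `|psi|); last by ring.
by rewrite -splitr.
Qed.

End RelativeBoundZero.

Theorem propositionA6 (R : realType) (A : cstarAlgType R)
    (E : hilbertModType A) (T S : ddOperator E) :
  regular_op T -> selfadjoint_op T -> relatively_compact T S ->
  forall eps : R, 0 < eps ->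
  exists2 C : R, 0 <= C &
    forall psi : E, dom T psi ->
      `|S psi| <= eps%:C * `|T psi| + C%:C * `|psi|.
Proof.
move=> _ Tsa [TS [K cK graphK] _] eps eps0.
have SK psi : dom T psi -> S psi = K (T psi + 'i *: psi).
  move=> Tpsi.
  (* This pair lies in the graph of [S] composed with the inverse of [T + 'i], with [psi] as
     intermediate point. *)
  have : [set p | p.2 = K p.1] (T psi + 'i *: psi, S psi); last by [].
  rewrite -graphK; exists psi => /=; last by split=> //; apply: TS.
  by exists (psi, T psi).
have [|C C0 SC] := bound_zero_compact 'i Tsa cK (eps := eps%:C).
  by rewrite ltcR.
(* A nonnegative element of [R[i]] equals its real part, which supplies the constant in [R]. *)
have CE : (complex.Re C)%:C = C by rewrite RRe_real// realE C0.
exists (complex.Re C); first by rewrite -lecR CE.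
by move=> psi Tpsi; rewrite CE SK// SC.
Qed.
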